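(* Let $r\geq 2$ be an integer and let $p>1$ be real. If $G$ is a $K_{r+1}$-free graph of order $n$, then $\lambda^{(p)}(G)<\lambda^{(p)}(T_r(n))$, unless $G=T_r(n)$.
   Context: For a graph $G$ with vertex set $\{1,\dots,n\}$ and real $p\geq1$, the $p$-spectral radius is $\lambda^{(p)}(G)=\max\{2\sum_{\{i,j\}\in E(G)}x_ix_j : x_1,\dots,x_n\in\mathbb{R},\ |x_1|^p+\cdots+|x_n|^p=1\}$. $T_r(n)$ denotes the Turán graph: the complete $r$-partite graph of order $n$ whose parts have sizes $\lfloor n/r\rfloor$ or $\lceil n/r\rceil$. $K_{r+1}$ is the complete graph on $r+1$ vertices. *)

(* Defs.v *)
From HB Require Import structures.
From mathcomp Require Import all_boot all_order all_algebra all_fingroup.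
From mathcomp Require Import all_classical all_reals all_analysis.
From mathcomp Require Import zify.

Set Implicit Arguments.
Unset Strict Implicit.
Unset Printing Implicit Defensive.

Import Order.TTheory GRing.Theory Num.Theory.
Import numFieldNormedType.Exports.

Local Open Scope classical_set_scope.
Local Open Scope ring_scope.

Record sgraph (n : nat) := SGraph {
  adj :> rel 'I_n;
  adj_sym : symmetric adj;
  adj_irr : irreflexive adj
}.

Definition complete_graph (n : nat) : sgraph n :=
  @SGraph n [rel i j | i != j] (fun i j => congr1 negb (eq_sym i j))
    (fun i => congr1 negb (eqxx i)).

(* [H] occurs in [G] as a (not necessarily induced) subgraph. *)
Definition contains_copy (m n : nat) (H : sgraph m) (G : sgraph n) : Prop :=
  exists f : 'I_m -> 'I_n, injective f /\ forall i j, H i j -> G (f i) (f j).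

Definition clique_free (k n : nat) (G : sgraph n) : Prop :=
  ~ contains_copy (complete_graph k) G.

Definition isomorphic (n : nat) (G H : sgraph n) : Prop :=
  exists s : 'S_n, forall i j, H (s i) (s j) = G i j.

(* [c] assigns to each vertex its part; when [n < r] some parts are empty.
   For [0 < r], [(n + r.-1) %/ r] is the ceiling of n/r. *)
Definition is_turan (r n : nat) (T : sgraph n) : Prop :=
  exists c : 'I_n -> 'I_r,
    (forall i j, T i j = (c i != c j)) /\
    (forall k, #|[set i | c i == k]%SET| = (n %/ r)%N \/
               #|[set i | c i == k]%SET| = ((n + r.-1) %/ r)%N).

(* The edges {i, j} are enumerated as the ordered pairs i < j. *)
Definition edge_form (R : realType) (n : nat) (G : sgraph n) (x : 'rV[R]_n) : R :=
  2 * \sum_(i < n) \sum_(j < n | (i < j)%N && G i j) x 0 i * x 0 j.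

Definition p_sphere (R : realType) (n : nat) (p : R) : set 'rV[R]_n :=
  [set x | \sum_(i < n) `|x 0 i| `^ p = 1].

(* The supremum is a maximum whenever [0 < n] and [1 <= p], see
   [p_spectral_radius_max]; for [n = 0] it is 0, by the convention for
   [sup set0]. *)
Definition p_spectral_radius (R : realType) (n : nat) (p : R) (G : sgraph n) : R :=
  sup [set edge_form G x | x in p_sphere p].

Lemma norm_powR_continuous (R : realType) (p : R) : 1 <= p ->
  continuous (fun a : R => `|a| `^ p).
Proof.
move=> p1 a; have p0 : 0 < p by exact: lt_le_trans p1.
have [->|a0] := eqVneq a 0.
  rewrite /continuous_at /= normr0 powR0 ?gt_eqF//.
  apply/cvgrPdist_le => /= e e0; near=> x.
  rewrite sub0r normrN ger0_norm ?powR_ge0//.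
  have [->|x0] := eqVneq x 0; first by rewrite normr0 powR0 ?gt_eqF// ltW.
  apply: (@le_trans _ _ `|x|).
    apply: ge1r_powR => //; rewrite normr_gt0 x0/=.
    near: x; rewrite !near_simpl; exact: (@nbhs0_le _ R^o).
  near: x; exact: (@nbhs0_le _ R^o).
apply: (@continuous_comp _ _ _ (fun x : R => `|x|) (fun y : R => y `^ p)).
  exact: (@norm_continuous _ R^o).
apply/differentiable_continuous/derivable1_diffP/derivable_powR.
by rewrite in_itv /= andbT normr_gt0.
Unshelve. all: by end_near. Qed.

Lemma continuous_sum_cond (R : realType) (T : topologicalType) (I : finType)
  (P : pred I) (f : I -> T -> R) : (forall i, continuous (f i)) ->
  continuous (fun x => \sum_(i | P i) f i x).
Proof.
move=> cf; elim: (index_enum I) => [|i s IH] x.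
  under eq_fun do rewrite big_nil; exact: cvg_cst.
under eq_fun do rewrite big_cons; case: (P i); last exact: IH.
apply: cvgD; [exact: cf | exact: IH].
Qed.

Lemma p_sphere_compact (R : realType) (n : nat) (p : R) : 1 <= p ->
  compact (@p_sphere R n p).
Proof.
move=> p1; have p0 : 0 < p by exact: lt_le_trans p1.
apply: bounded_closed_compact.
  exists 1; split => // M M1 x xS; apply: le_trans (ltW M1).
  rewrite [`|x|]mx_normrE; apply: bigmax_le => // -[i j] _ /=; rewrite ord1.
  rewrite leNgt; apply/negP => xj1.
  have : 1 < `|x 0 j| `^ p.
    have := gt0_ltr_powR p0 _ _ xj1; rewrite powR1; apply.
      by rewrite nnegrE.
    by rewrite nnegrE.
  apply/negP; rewrite -leNgt -xS (bigD1 j)//= lerDl sumr_ge0//.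
rewrite (_ : @p_sphere R n p =
  (fun x : 'rV[R]_n => \sum_(i < n) `|x 0 i| `^ p) @^-1` [set 1])//.
apply: preimage_closed (@closed_eq _ 1) => x _.
move: x; apply: continuous_sum_cond => i x.
apply: (@continuous_comp _ _ _ (fun y : 'rV[R]_n => y 0 i)
  (fun a : R => `|a| `^ p)); first exact: coord_continuous.
exact: norm_powR_continuous.
Qed.

Lemma p_spectral_radius_max (R : realType) (n : nat) (p : R) (G : sgraph n) :
  (0 < n)%N -> 1 <= p ->
  (exists2 x, p_sphere p x & edge_form G x = p_spectral_radius p G) /\
  (forall y, p_sphere p y -> edge_form G y <= p_spectral_radius p G).
Proof.
move=> n0 p1; have p0 : 0 < p by exact: lt_le_trans p1.
have S0 : @p_sphere R n p !=set0.
  exists (delta_mx 0 (Ordinal n0)); rewrite /p_sphere /= (bigD1 (Ordinal n0))//=.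
  rewrite mxE !eqxx /= normr1 powR1 big1 ?addr0// => i /negPf i0.
  by rewrite mxE i0 andbF normr0 powR0// gt_eqF.
have cf : continuous (@edge_form R n G).
  move=> x; apply: (@continuousM _ _ (fun=> 2)); first exact: cst_continuous.
  move: x; apply: continuous_sum_cond => i; apply: continuous_sum_cond => j x.
  by apply: continuousM; exact: coord_continuous.
have [c cS cmax] := EVT_max_rV S0 (@p_sphere_compact R n p p1)
  (continuous_subspaceT cf).
rewrite inE in cS.
have ub y : p_sphere p y -> edge_form G y <= edge_form G c.
  by move=> yS; apply: cmax; rewrite inE.
have e : p_spectral_radius p G = edge_form G c.
  apply/eqP; rewrite eq_le; apply/andP; split.
    apply: ge_sup; first by exists (edge_form G c), c.
    by move=> _ [y yS <-]; exact: ub.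
  apply: ub_le_sup; last by exists c.
  by exists (edge_form G c) => _ [y yS <-]; exact: ub.
by rewrite e; split=> //; exists c.
Qed.

Lemma turan_exists (r n : nat) : (0 < r)%N -> exists T : sgraph n, is_turan r T.
Proof.
move=> r0; pose c (i : 'I_n) : 'I_r := Ordinal (ltn_pmod i r0).
have cs : symmetric [rel i j | c i != c j] by move=> i j /=; rewrite eq_sym.
have ci : irreflexive [rel i j | c i != c j] by move=> i /=; rewrite eqxx.
exists (SGraph cs ci), c; split=> // k.
have -> : #|[set i | c i == k]%SET| = (\sum_(i < n) (i %% r == k))%N.
  by rewrite -sum1dep_card big_mkcond /=; apply: eq_bigr => i _; rewrite -val_eqE /=; case: eqP.
have -> : (\sum_(i < n) (i %% r == k) = (n + (r.-1 - k)) %/ r)%N.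
  have kr := ltn_ord k; elim: n {c cs ci} => [|m IH].
    by rewrite big_ord0 add0n divn_small//; lia.
  rewrite big_ord_recr /= IH {IH}.
  set q := (m %/ r)%N; set a := (m %% r)%N.
  have em : m = (q * r + a)%N by exact: divn_eq.
  have lm : (a < r)%N by exact: ltn_pmod.
  have [ek|nk] := eqVneq a (nat_of_ord k).
    rewrite (_ : (m + _)%N = (q * r + r.-1)%N); last by lia.
    rewrite (_ : (m.+1 + _)%N = (q.+1 * r + 0)%N); last by lia.
    by rewrite !divnMDl// div0n divn_small; lia.
  rewrite addn0; have [lt|ge] := ltnP a k.
    rewrite (_ : (m + _)%N = (q * r + (a + (r.-1 - k)))%N); last by lia.
    rewrite (_ : (m.+1 + _)%N = (q * r + (a.+1 + (r.-1 - k)))%N); last by lia.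
    by rewrite !divnMDl// !divn_small; lia.
  rewrite (_ : (m + _)%N = (q.+1 * r + (a - k.+1))%N); last by lia.
  rewrite (_ : (m.+1 + _)%N = (q.+1 * r + (a - k))%N); last by lia.
  by rewrite !divnMDl// !divn_small; lia.
have kr := ltn_ord k.
have h1 : (n %/ r <= (n + (r.-1 - k)) %/ r)%N by apply: leq_div2r; lia.
have h2 : ((n + (r.-1 - k)) %/ r <= (n + r.-1) %/ r)%N by apply: leq_div2r; lia.
have h3 : ((n + r.-1) %/ r <= (n + r) %/ r)%N by apply: leq_div2r; lia.
rewrite (divnDr n (dvdnn r)) divnn r0 in h3; lia.
Qed.

(* Main.v *)
(* Let x >= 0 be an extremal vector of G.  Erdos' degree majorization with weights
   x gives a complete r-partite graph H on the same vertices in which no weighted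
   degree is smaller, so lambda(G) <= lambda(H).  Among the complete r-partite
   graphs only the balanced ones maximize lambda: if part k has at least two more
   vertices than part l, with sums s and t of the entries of an extremal vector,
   then either some vertex of part k can be moved to part l, or every entry in
   part k is at least s - t, and moving one vertex while keeping s and t, spread
   evenly, strictly decreases the p-norm by the strict convexity of u |-> u^p.
   If lambda(G) attains the maximum, then H is balanced and x is extremal for H,
   hence positive since p > 1; so all weighted degrees agree, and the equality
   case of the majorization gives G = H. *)
Require Import Defs.
From mathcomp Require Import all_boot all_order all_algebra.
From mathcomp Require Import all_classical all_reals all_analysis.
From mathcomp Require Import all_fingroup zify ring lra.
Import Order.TTheory GRing.Theory Num.Theory.
Local Open Scope ring_scope.

Set Implicit Arguments.
Unset Strict Implicit.
Unset Printing Implicit Defensive.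

(** * Convexity of real powers *)

Section RealPowers.
Variables (R : realType) (p : R).
Hypothesis p1 : 1 < p.

Let p0 : 0 < p. Proof. exact: lt_trans ltr01 p1. Qed.

(** Write u^p as u times exp((p - 1) ln u). The bounds ln u >= 1 - 1/u and exp y > 1 + y for nonzero
    y then give exactly 1 + p (u - 1). *)
Lemma bernoulli_powR (u : R) : 0 <= u -> u != 1 -> 1 + p * (u - 1) < u `^ p.
Proof.
move=> u0 u1; have [->|un0] := eqVneq u 0.
  by rewrite powR0 ?gt_eqF//; move: p1; lra.
have {u0 un0} u0 : 0 < u by rewrite lt_neqAle eq_sym un0.
have -> : u `^ p = u * u `^ (p - 1).
  rewrite -[X in X * _](powRr1 (ltW u0)) -powRD ?subrKC//.
  by rewrite gt_eqF ?implybT.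
have lnu : 1 - u^-1 <= ln u.
  have := expR_ge1Dx (- ln u); rewrite expRN lnK ?posrE//; lra.
have e0 : (p - 1) * (1 - u^-1) != 0.
  rewrite mulf_neq0//; first by rewrite subr_eq0 gt_eqF.
  by rewrite subr_eq0 eq_sym invr_eq1.
have lt1 := expR_gt1Dx e0.
have le2 : expR ((p - 1) * (1 - u^-1)) <= u `^ (p - 1).
  by rewrite /powR gt_eqF// ler_expR ler_wpM2l// subr_ge0 ltW.
have : u * (1 + (p - 1) * (1 - u^-1)) < u * u `^ (p - 1).
  by rewrite ltr_pM2l// (lt_le_trans lt1 le2).
suff -> : u * (1 + (p - 1) * (1 - u^-1)) = 1 + p * (u - 1) by [].
by field; rewrite gt_eqF.
Qed.

(** Bernoulli's inequality at t / w, scaled by w^p. The derivative p w^(p - 1) is written with the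
    exponent p only, so that [field] can treat w^p as an atom. *)
Lemma powR_tangent_lt (w t : R) : 0 < w -> 0 <= t -> t != w ->
  w `^ p + p * w `^ p / w * (t - w) < t `^ p.
Proof.
move=> w0 t0 tw.
have -> : t = w * (t / w) by field; rewrite gt_eqF.
have u0 : 0 <= t / w by rewrite divr_ge0// ltW.
have u1 : t / w != 1.
  by apply: contra_neq tw => /(congr1 ( *%R^~ w)); rewrite divfK ?gt_eqF// mul1r.
rewrite [in ltRHS]powRM ?(ltW w0)//.
have := bernoulli_powR u0 u1; rewrite -(ltr_pM2l (powR_gt0 p w0)).
suff -> : w `^ p + p * w `^ p / w * (w * (t / w) - w) =
  w `^ p * (1 + p * (t / w - 1)) by [].
by field; rewrite gt_eqF.
Qed.

Lemma powR_tangent_le (w t : R) : 0 < w -> 0 <= t ->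
  w `^ p + p * w `^ p / w * (t - w) <= t `^ p.
Proof.
move=> w0 t0; have [->|tw] := eqVneq t w; first by rewrite subrr mulr0 addr0.
exact: ltW (powR_tangent_lt w0 t0 tw).
Qed.

(** Jensen's inequality: the tangents at the mean s / a are summed, and their linear terms cancel.
    The cardinality enters through the real [a], so it can be supplied in a form such as m + 1. *)
Lemma power_mean (I : finType) (P : pred I) (f : I -> R) (a s : R) :
  (forall i, P i -> 0 <= f i) -> #|P|%:R = a -> \sum_(i | P i) f i = s ->
  0 < s -> a * (s / a) `^ p <= \sum_(i | P i) f i `^ p.
Proof.
move=> f0 ea es s0.
have a0 : 0 < a.
  rewrite -ea ltr0n lt0n; apply: contraTneq s0 => /card0_eq P0.
  by rewrite -es big_pred0 ?ltxx// => i; have := P0 i; rewrite inE => ->.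
set w := s / a; have w0 : 0 < w by rewrite divr_gt0.
have : \sum_(i | P i) (w `^ p + p * w `^ p / w * (f i - w)) <=
    \sum_(i | P i) f i `^ p.
  by apply: ler_sum => i Pi; exact: powR_tangent_le w0 (f0 _ Pi).
suff -> : \sum_(i | P i) (w `^ p + p * w `^ p / w * (f i - w)) = a * w `^ p by [].
rewrite big_split/= -mulr_sumr sumrB es !sumr_const -(mulr_natl (w `^ p)) -(mulr_natl w) ea.
have -> : a * w = s by rewrite /w; field; rewrite gt_eqF.
by rewrite subrr mulr0 addr0.
Qed.

(* The slope of [t `^ p] between [1] and [1 + 1 / m] increases with [1 / m]. *)
Lemma powR_slope_lt (b m : R) : 1 <= b -> b < m ->
  m * ((m + 1) / m) `^ p - m < b * ((b + 1) / b) `^ p - b.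
Proof.
move=> b1 bm; have b0 : 0 < b by lra.
have m0 : 0 < m by lra.
set q := (m + 1) / m; set t := (b + 1) / b.
have q0 : 0 < q by rewrite divr_gt0//; lra.
have t0 : 0 <= t by rewrite divr_ge0//; lra.
have tq : t != q.
  have -> : t = 1 + b^-1 by rewrite /t; field; rewrite gt_eqF.
  have -> : q = 1 + m^-1 by rewrite /q; field; rewrite gt_eqF.
  by rewrite (inj_eq (addrI _)) (inj_eq invr_inj) lt_eqF.
have h1 := powR_tangent_lt q0 t0 tq.
have h2 := powR_tangent_le q0 ler01; rewrite powR1 in h2.
move: h1 h2; set Q := q `^ p; set D := p * Q / q; move=> h1 h2.
have h3 : b * (Q + D * (t - q)) < b * t `^ p by rewrite ltr_pM2l.
have h4 : (m - b) * (Q + D * (1 - q)) <= (m - b) * 1 by rewrite ler_wpM2l//; lra.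
(* Since m q = b t + (m - b), the weighted tangent values at t and 1 add up to m Q and the slope D
   drops out. *)
have e : b * (Q + D * (t - q)) + (m - b) * (Q + D * (1 - q)) = m * Q.
  by rewrite /t /q; field; rewrite !gt_eqF.
lra.
Qed.

(** The parts have sizes m + 1 and b before the move, m and b + 1 after it. With y = s / (m + 1), w
    = t / (b + 1), A = ((m + 1) / m)^p and B = ((b + 1) / b)^p, the claim becomes y^p (m A - m - 1)
    < w^p (b B - b - 1), which follows from y <= w and the comparison of slopes. *)
Lemma powR_rebalance_lt (m b s t : R) : 1 <= b -> b + 1 <= m -> 0 < s ->
  m * s <= (m + 1) * t ->
  m * (s / m) `^ p + (b + 1) * (t / (b + 1)) `^ p <
  (m + 1) * (s / (m + 1)) `^ p + b * (t / b) `^ p.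
Proof.
move=> b1 bm s0 st.
have b0 : 0 < b by lra.
have m0 : 0 < m by lra.
have m10 : 0 < m + 1 by lra.
have b10 : 0 < b + 1 by lra.
have t0 : 0 < t by rewrite -(pmulr_rgt0 _ m10) (lt_le_trans _ st)// mulr_gt0.
set y := s / (m + 1); set w := t / (b + 1).
have y0 : 0 < y by rewrite divr_gt0.
have w0 : 0 < w by rewrite divr_gt0.
have -> : s / m = y * ((m + 1) / m) by rewrite /y; field; rewrite !gt_eqF.
have -> : t / b = w * ((b + 1) / b) by rewrite /w; field; rewrite !gt_eqF.
have q0 : 0 <= (m + 1) / m by rewrite divr_ge0 ?ltW.
have r0 : 0 <= (b + 1) / b by rewrite divr_ge0 ?ltW.
rewrite (powRM p (ltW y0) q0) (powRM p (ltW w0) r0).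
have yw : y `^ p <= w `^ p.
  apply: (ge0_ler_powR (ltW p0)); [by rewrite nnegrE ltW|by rewrite nnegrE ltW|].
  rewrite /y /w ler_pdivrMr// mulrAC ler_pdivlMr//.
  have : s * (b + 1) <= s * m by rewrite ler_pM2l.
  lra.
have slope := powR_slope_lt b1 (lt_le_trans (ltr_pwDr ltr01 (lexx b)) bm).
(* The tangent at 1 even gives the lower bound p - 1. *)
have K0 : 0 <= b * ((b + 1) / b) `^ p - b - 1.
  have := powR_tangent_le ltr01 (divr_ge0 (ltW b10) (ltW b0)).
  rewrite powR1 divr1 mulr1 => h.
  have : b * (1 + p * ((b + 1) / b - 1)) <= b * ((b + 1) / b) `^ p by rewrite ler_pM2l.
  have -> : b * (1 + p * ((b + 1) / b - 1)) = b + p by field; rewrite gt_eqF.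
  move: p1; lra.
have yp0 := powR_gt0 p y0.
move: slope K0 yw yp0.
set A := ((m + 1) / m) `^ p; set B := ((b + 1) / b) `^ p.
move: (y `^ p) (w `^ p) => Y W AB B0 YW Y0.
have h1 : Y * (m * A - m) < Y * (b * B - b) by rewrite ltr_pM2l.
have h2 : Y * (b * B - b - 1) <= W * (b * B - b - 1) by rewrite ler_wpM2r.
lra.
Qed.

End RealPowers.

(** * Weighted degree majorization *)

(* The idea: take a vertex [v] of maximal weighted degree, give its
   non-neighbours a new colour, and recurse in its neighbourhood [N], which
   contains no clique of size [r]. *)
Lemma erdos_majorization (R : realDomainType) (n : nat) (G : sgraph n)
    (x : 'I_n -> R) (r : nat) (A : {set 'I_n}) :
  (forall i, 0 <= x i) ->
  (forall B : {set 'I_n}, B \subset A ->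
    {in B &, forall i j, i != j -> G i j} -> (#|B| <= r)%N) ->
  exists c : 'I_n -> nat,
    [/\ {in A, forall i, (c i < r)%N},
        {in A, forall i, \sum_(j | (j \in A) && G i j) x j <=
                         \sum_(j | (j \in A) && (c i != c j)) x j} &
        {in A, forall i, 0 < x i} ->
        {in A, forall i, \sum_(j | (j \in A) && G i j) x j =
                         \sum_(j | (j \in A) && (c i != c j)) x j} ->
        {in A &, forall i j, G i j = (c i != c j)}].
Proof.
move=> x0; elim: r A => [|r IH] A hA.
  exists (fun=> 0%N); suff A0 : forall i, i \notin A.
    by split => [i iA|i iA|_ _ i j iA]; have := A0 i; rewrite iA.
  move=> i; apply/negP => iA; suff : (#|[set i]| <= 0)%N by rewrite cards1.
  apply: hA; first by rewrite finset.sub1set.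
  by move=> a b /finset.set1P-> /finset.set1P->; rewrite eqxx.
have [->|[v0 v0A]] := set_0Vmem A.
  by exists (fun=> 0%N); split => [i|i|_ _ i j]; rewrite inE.
pose d i := \sum_(j | (j \in A) && G i j) x j.
have [v vA vmax] := @arg_maxP _ _ _ v0 (mem A) d v0A.
pose N := [set j in A | G v j].
have NA j : j \in N -> j \in A by rewrite inE => /andP[].
(* A clique in [N] extends by [v] to a clique in [A], so the bound drops by one. *)
have [|c [cr cle ceq]] := IH N.
  move=> B /fintype.subsetP BN clB.
  have vB : v \notin B.
    by apply/negP => /BN; rewrite inE adj_irr andbF.
  suff : (#|v |: B| <= r.+1)%N by rewrite cardsU1 vB.
  apply: hA.
    by apply/fintype.subsetP => j /finset.setU1P[->//|/BN/NA].
  move=> i j /finset.setU1P[->|iB] /finset.setU1P[->|jB]; rewrite ?eqxx//.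
  - by have := BN _ jB; rewrite inE => /andP[].
  - by have := BN _ iB; rewrite adj_sym inE => /andP[].
  - exact: clB.
pose c' i := if i \in N then c i else r.
have split_sum (P : pred 'I_n) : \sum_(j | (j \in A) && P j) x j =
    \sum_(j | (j \in N) && P j) x j +
    \sum_(j | (j \in A) && P j && (j \notin N)) x j.
  rewrite (bigID (mem N)) /=; congr (_ + _); apply: eq_bigl => j.
  by case jN: (j \in N); rewrite ?andbF ?andbT//= NA.
have inN i : i \in N -> \sum_(j | (j \in A) && (c' i != c' j)) x j =
    \sum_(j | (j \in N) && (c i != c j)) x j +
    \sum_(j | (j \in A) && (j \notin N)) x j.
  move=> iN; rewrite split_sum; congr (_ + _); apply: eq_bigl => j.
    by rewrite /c' iN; case jN: (j \in N).
  rewrite /c' iN; case jN: (j \in N); rewrite ?andbF ?andbT//.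
  by rewrite ltn_eqF ?cr// andbT.
(* A vertex outside [N] is joined by [c'] to exactly [N], so its new weighted degree is the maximal
   one, that of [v]. *)
have notinN i : i \in A -> i \notin N ->
    \sum_(j | (j \in A) && (c' i != c' j)) x j = d v.
  move=> iA iN; apply: eq_bigl => j; rewrite /c' (negPf iN).
  case jN: (j \in N); last by rewrite eqxx andbF; move: jN; rewrite inE => ->.
  by rewrite gtn_eqF ?cr// andbT NA//; move: jN; rewrite inE => /andP[_ ->].
have ge0 (P Q : pred 'I_n) : (forall j, P j -> Q j) ->
    \sum_(j | P j) x j <= \sum_(j | Q j) x j.
  move=> PQ; rewrite [leRHS](bigID P)/= (eq_bigl P).
    by rewrite lerDl sumr_ge0.
  by move=> j; case Pj: (P j); rewrite ?andbF ?PQ.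
have tail i : \sum_(j | (j \in A) && G i j && (j \notin N)) x j <=
    \sum_(j | (j \in A) && (j \notin N)) x j.
  by apply: ge0 => j /andP[/andP[-> _] ->].
exists c'; split.
- by move=> i iA; rewrite /c'; case: ifP => // iN; rewrite ltnS ltnW ?cr.
- move=> i iA; have [iN|iN] := boolP (i \in N).
    by rewrite inN// split_sum lerD ?cle.
  by rewrite notinN//; exact: vmax.
move=> xpos deq.
(* The degree bound is a sum of two inequalities, so equality of the totals forces equality in
   each. *)
have eqN i : i \in N ->
    \sum_(j | (j \in N) && G i j) x j = \sum_(j | (j \in N) && (c i != c j)) x j /\
    \sum_(j | (j \in A) && G i j && (j \notin N)) x j =
    \sum_(j | (j \in A) && (j \notin N)) x j.
  move=> iN; have := deq _ (NA _ iN); rewrite inN// split_sum.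
  have := cle _ iN; have := tail i; split; lra.
have GN : {in N &, forall i j, G i j = (c i != c j)}.
  apply: ceq => i iN; first exact/xpos/NA.
  by have [] := eqN i iN.
have zero (P : pred 'I_n) j : \sum_(j | (j \in A) && P j) x j = 0 -> j \in A -> P j = false.
  move=> s0 jA; apply/negP => Pj.
  have : x j = 0 by apply: (psumr_eq0P _ s0); rewrite ?jA.
  by have := xpos _ jA; move=> /[swap] ->; rewrite ltxx.
(* The weights are positive, so equality of the tails leaves no non-edge between [N] and the
   rest. *)
have GNout i j : i \in N -> j \in A -> j \notin N -> G i j.
  move=> iN jA jN; have [_] := eqN i iN.
  rewrite [RHS](bigID (G i))/= (eq_bigl (fun j => (j \in A) && (j \notin N) && G i j)).
    move/eqP; rewrite eq_sym -subr_eq0 addrAC subrr add0r => /eqP.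
    rewrite (eq_bigl (fun j => (j \in A) && ((j \notin N) && ~~ G i j))).
      by move/(zero _ j)/(_ jA); rewrite jN => /negbFE.
    by move=> k; rewrite andbA.
  by move=> k; rewrite andbAC.
(* By [GNout] the set [N] already accounts for the whole degree [d v], so no weight remains for
   neighbours outside [N]. *)
have outout i j : i \in A -> i \notin N -> j \in A -> j \notin N -> G i j = false.
  move=> iA iN jA jN; have := deq _ iA; rewrite notinN// split_sum.
  rewrite (eq_bigl (fun j => (j \in A) && G v j)); last first.
    move=> k; case kN: (k \in N).
      by rewrite adj_sym (GNout k i)//; move: kN; rewrite inE => ->.
    by move: kN; rewrite inE => ->.
  move/eqP; rewrite -subr_eq0 addrAC subrr add0r => /eqP.
  rewrite (eq_bigl (fun j => (j \in A) && (G i j && (j \notin N)))).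
    by move/(zero _ j)/(_ jA); rewrite jN andbT.
  by move=> k; rewrite andbA.
move=> i j iA jA; rewrite /c'.
case: (boolP (i \in N)) => iN; case: (boolP (j \in N)) => jN.
- exact: GN.
- by rewrite GNout// ltn_eqF ?cr.
- by rewrite adj_sym GNout// gtn_eqF ?cr.
- by rewrite eqxx outout.
Qed.

(** * The p-spectral radius *)

Definition wdeg (R : realType) (n : nat) (G : sgraph n) (x : 'rV[R]_n) (i : 'I_n) : R :=
  \sum_(j | G i j) x 0 j.

Lemma edge_form_wdeg (R : realType) (n : nat) (G : sgraph n) (x : 'rV[R]_n) :
  edge_form G x = \sum_i x 0 i * wdeg G x i.
Proof.
transitivity (\sum_i \sum_(j | G i j) x 0 i * x 0 j); last first.
  by apply: eq_bigr => i _; rewrite mulr_sumr.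
have -> : \sum_i \sum_(j | G i j) x 0 i * x 0 j =
    \sum_(i < n) \sum_(j < n | (i < j)%N && G i j) x 0 i * x 0 j +
    \sum_(i < n) \sum_(j < n | (j < i)%N && G i j) x 0 i * x 0 j.
  rewrite -big_split/=; apply: eq_bigr => i _.
  rewrite (bigID (fun j : 'I_n => (i < j)%N))/=; congr (_ + _); apply: eq_bigl => j.
    by rewrite andbC.
  rewrite -leqNgt.
  by case: ltngtP => /= [_|_|/ord_inj->]; rewrite ?andbT ?andbF ?adj_irr.
have -> : \sum_(i < n) \sum_(j < n | (j < i)%N && G i j) x 0 i * x 0 j =
    \sum_(i < n) \sum_(j < n | (i < j)%N && G i j) x 0 i * x 0 j.
  rewrite (exchange_big_dep predT)//=; apply: eq_bigr => j _.
  by apply: eq_big => i => [|_]; [rewrite adj_sym | rewrite mulrC].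
by rewrite /edge_form mulr2n mulrDl mul1r.
Qed.

Section SpectralRadius.
Variables (R : realType) (p : R).
Hypothesis p1 : 1 < p.

Let p0 : 0 < p. Proof. exact: lt_trans ltr01 p1. Qed.

Lemma edge_form_scale (n : nat) (G : sgraph n) (a : R) (x : 'rV[R]_n) :
  edge_form G (a *: x) = a ^+ 2 * edge_form G x.
Proof.
rewrite /edge_form mulrCA; congr (_ * _); rewrite mulr_sumr.
apply: eq_bigr => i _; rewrite mulr_sumr; apply: eq_bigr => j _.
by rewrite !mxE expr2 mulrACA.
Qed.

(** The edge form has degree 2 and the power sum N has degree p, so rescaling by N^(-1/p) onto the
    sphere costs the factor N^(2/p). Test vectors can thus be used without normalization. *)
Lemma edge_form_le_radius (n : nat) (G : sgraph n) (x : 'rV[R]_n) :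
  0 < \sum_i `|x 0 i| `^ p ->
  edge_form G x <= p_spectral_radius p G * (\sum_i `|x 0 i| `^ p) `^ (2 / p).
Proof.
move=> N_gt0.
have n0 : (0 < n)%N.
  by case: n G x N_gt0 => // G x; rewrite big_ord0 ltxx.
move: N_gt0; set N := \sum_i _ => N0.
have [_ ub] := p_spectral_radius_max G n0 (ltW p1).
set a := N `^ (- p^-1); have a0 : 0 < a by exact: powR_gt0.
have /ub : p_sphere p (a *: x).
  rewrite /p_sphere/=; under eq_bigr do
    rewrite mxE normrM (powRM _ (normr_ge0 _) (normr_ge0 _)).
  rewrite -mulr_sumr -/N (gtr0_norm a0) /a -powRrM mulNr mulVf ?gt_eqF//.
  by rewrite powR_inv1 ?(ltW N0)// mulVf ?gt_eqF.
rewrite edge_form_scale.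
have e : a ^+ 2 * N `^ (2 / p) = 1.
  rewrite -powR_mulrn ?(ltW a0)// /a -powRrM -powRD ?(gt_eqF N0) ?implybT//.
  by rewrite mulNr [2 / p]mulrC addrC subrr powRr0.
move=> h; by rewrite -[leLHS]mul1r -[X in X * _ <= _]e mulrAC ler_wpM2r ?powR_ge0.
Qed.

(** Passing to absolute values stays on the sphere and does not lower the edge form. *)
Lemma radius_attained (n : nat) (G : sgraph n) : (0 < n)%N ->
  exists x : 'rV[R]_n, [/\ p_sphere p x, forall i, 0 <= x 0 i &
    edge_form G x = p_spectral_radius p G].
Proof.
move=> n0; have [[x xS xe] ub] := p_spectral_radius_max G n0 (ltW p1).
pose y : 'rV[R]_n := map_mx Num.norm x.
have yS : p_sphere p y.
  rewrite /p_sphere/= -[RHS]xS; apply: eq_bigr => i _.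
  by rewrite mxE normr_id.
exists y; split => // [i|]; first by rewrite mxE.
apply/eqP; rewrite eq_le ub//= -xe /edge_form ler_pM2l//.
apply: ler_sum => i _; apply: ler_sum => j _.
by rewrite !mxE -normrM ler_norm.
Qed.

Lemma radius_gt0 (n : nat) (G : sgraph n) (i j : 'I_n) : G i j ->
  0 < p_spectral_radius p G.
Proof.
move=> Gij; pose x : 'rV[R]_n := \row__ 1.
have x0 : 0 < \sum_k `|x 0 k| `^ p.
  by rewrite (bigD1 i)//= mxE normr1 powR1 ltr_pwDl// sumr_ge0.
have := edge_form_le_radius G x0.
suff e0 : 0 < edge_form G x.
  by move/(lt_le_trans e0); rewrite pmulr_lgt0// powR_gt0.
rewrite edge_form_wdeg (bigD1 i)//= ltr_pwDl//.
  rewrite mxE mul1r /wdeg (bigD1 j)//= mxE ltr_pwDl// sumr_ge0// => k _.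
  by rewrite mxE.
rewrite sumr_ge0// => k _; rewrite mxE mul1r sumr_ge0// => l _.
by rewrite mxE.
Qed.

Lemma radius_le_isomorphic (n : nat) (G H : sgraph n) : (0 < n)%N ->
  isomorphic G H -> p_spectral_radius p G <= p_spectral_radius p H.
Proof.
move=> n0 [s sGH]; have [x [xS _ <-]] := radius_attained G n0.
have [_ ub] := p_spectral_radius_max H n0 (ltW p1).
pose y : 'rV[R]_n := \row_i x 0 ((s^-1)%g i).
have -> : edge_form G x = edge_form H y.
  rewrite !edge_form_wdeg [RHS](reindex_inj (@perm_inj _ s)).
  apply: eq_bigr => i _; rewrite mxE permK; congr (_ * _).
  rewrite /wdeg [RHS](reindex_inj (@perm_inj _ s)).
  by apply: eq_big => j => [|_]; rewrite ?sGH// mxE permK.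
apply: ub; rewrite /p_sphere/= -[RHS]xS (reindex_inj (@perm_inj _ s)).
by apply: eq_bigr => i _; rewrite mxE permK.
Qed.

(* Raising a zero entry to [e] gains order [e] in the edge form and costs only
   order [e `^ p] in the norm. *)
Lemma extremal_wdeg_eq0 (n : nat) (G : sgraph n) (x : 'rV[R]_n) (u : 'I_n) :
  p_sphere p x -> (forall i, 0 <= x 0 i) ->
  edge_form G x = p_spectral_radius p G -> x 0 u = 0 -> wdeg G x u = 0.
Proof.
move=> xS x0 xe xu; apply/eqP; rewrite eq_le sumr_ge0 ?andbT//.
set L := p_spectral_radius p G; set d := wdeg G x u.
have L0 : 0 <= L.
  rewrite -[L]xe edge_form_wdeg sumr_ge0// => i _.
  by rewrite mulr_ge0// sumr_ge0.
have key (e : R) : 0 < e -> e <= 1 -> 2 * d <= 3 * L * e `^ (p - 1).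
  move=> e0 e1; pose y : 'rV[R]_n := \row_i (if i == u then e else x 0 i).
  have yN : \sum_i `|y 0 i| `^ p = 1 + e `^ p.
    rewrite (bigD1 u)//= mxE eqxx gtr0_norm// addrC; congr (_ + _).
    rewrite -[RHS]xS [RHS](bigD1 u)//= xu normr0 powR0 ?gt_eqF// add0r.
    by apply: eq_bigr => i /negPf iu; rewrite mxE iu.
  have := edge_form_le_radius G (x := y).
  have ep0 : 0 <= e `^ p by exact: powR_ge0.
  have ep1 : e `^ p <= 1.
    by have := ge0_ler_powR (ltW p0) _ _ e1; rewrite powR1 !nnegrE (ltW e0) ler01; exact.
  rewrite yN => /(_ (ltr_wpDr ep0 ltr01)).
  (* The new entry counts once at [u] and once at its neighbours; there is no term in e^2 because
     [u] is not adjacent to itself. *)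
  have -> : edge_form G y = L + 2 * (e * d).
    have yu : wdeg G y u = d.
      apply: eq_bigr => j Guj; rewrite mxE; case: eqP => // ju.
      by rewrite ju adj_irr in Guj.
    have yv i : i != u -> y 0 i = x 0 i by move=> /negPf iu; rewrite mxE iu.
    have yd i : wdeg G y i = wdeg G x i + (if G u i then e else 0).
      rewrite /wdeg adj_sym; case: ifP => Giu; last first.
        rewrite addr0; apply: eq_bigr => j Gij; rewrite yv//.
        by apply: contraTneq Gij => ->; rewrite Giu.
      rewrite !(bigD1 (P := G i) u)//= xu add0r mxE eqxx addrC; congr (_ + _).
      by apply: eq_bigr => j /andP[_]; exact: yv.
    rewrite -[L]xe !edge_form_wdeg (bigD1 u)//= [in RHS](bigD1 u)//=.
    rewrite xu mul0r add0r yu mxE eqxx.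
    under eq_bigr => i iu do rewrite yv// yd mulrDr.
    rewrite big_split/= mulr2n mulrDl mul1r.
    suff -> : \sum_(i < n | i != u) x 0 i * (if G u i then e else 0) = e * d.
      by rewrite addrCA addrA.
    rewrite /d /wdeg mulr_sumr [RHS]big_mkcond/= [RHS](bigD1 u)//=.
    rewrite adj_irr add0r; apply: eq_bigr => i _.
    by case: ifP; rewrite ?mulr0// mulrC.
  (* The constant 3 comes from 2 / p <= 2 and e^p <= 1, which bound the power by (1 + e^p)^2 <= 1 +
     3 e^p. *)
  move=> h; have h2 : (1 + e `^ p) `^ (2 / p) <= 1 + 3 * e `^ p.
    apply: (@le_trans _ _ ((1 + e `^ p) `^ 2)).
      apply: ler_powR; first by rewrite lerDl.
      by rewrite ler_pdivrMr//; move: p1; lra.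
    rewrite (powR_mulrn 2) ?addr_ge0//.
    have : e `^ p * e `^ p <= e `^ p * 1 by rewrite ler_wpM2l.
    lra.
  have h3 : L * (1 + e `^ p) `^ (2 / p) <= L * (1 + 3 * e `^ p) by rewrite ler_wpM2l.
  have h4 : e `^ p = e * e `^ (p - 1).
    rewrite -[X in X * _](powRr1 (ltW e0)) -powRD ?subrKC//.
    by rewrite (gt_eqF e0) implybT.
  rewrite -(ler_pM2l e0); move: h h3; rewrite -/L h4; lra.
rewrite leNgt; apply/negP => d0.
have K0 : 0 < 3 * L + 2 * d by lra.
(* For e = t^(1 / (p - 1)) one has e^(p - 1) = t. As (3 L + 2 d) t = d, [key] would give 2 d <= d -
   2 d t. *)
set t := d / (3 * L + 2 * d); have t0 : 0 < t by exact: divr_gt0.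
have t1 : t <= 1 by rewrite ler_pdivrMr//; lra.
have q0 : 0 < p - 1 by rewrite subr_gt0.
have := key (t `^ (p - 1)^-1) (powR_gt0 _ t0) _.
rewrite -powRrM mulVf ?gt_eqF// (powRr1 (ltW t0)).
have -> : t `^ (p - 1)^-1 <= 1.
  have i0 : 0 <= (p - 1)^-1 by rewrite invr_ge0 ltW.
  by have := ge0_ler_powR i0 _ _ t1; rewrite powR1 !nnegrE (ltW t0) ler01; exact.
have : (3 * L + 2 * d) * t = d by rewrite /t; field; rewrite gt_eqF.
have : 0 < d * t by exact: mulr_gt0.
move=> a b /(_ isT); lra.
Qed.

End SpectralRadius.

(** * Complete multipartite graphs *)

Definition multipartite (n r : nat) (c : {ffun 'I_n -> 'I_r}) : sgraph n :=
  @SGraph n [rel i j | c i != c j]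
    (fun i j => congr1 negb (eq_sym (c i) (c j)))
    (fun i => congr1 negb (eqxx (c i))).

Definition part_size (n r : nat) (c : {ffun 'I_n -> 'I_r}) (k : 'I_r) : nat :=
  #|[set i | c i == k]%SET|.

Lemma sum_split2 (V : nmodType) (I : finType) (F : I -> V) (k l : I) : k != l ->
  \sum_m F m = F k + (F l + \sum_(m | (m != k) && (m != l)) F m).
Proof. by move=> kl; rewrite (bigD1 k)//= (bigD1 l)//= eq_sym. Qed.

Section Multipartite.
Variables (R : realType) (n r : nat).
Implicit Types (c : {ffun 'I_n -> 'I_r}) (x : 'rV[R]_n).

Definition part_sum c x (k : 'I_r) : R := \sum_(i | c i == k) x 0 i.

Lemma sum_part_sum c x : \sum_k part_sum c x k = \sum_i x 0 i.
Proof. by rewrite (partition_big c predT). Qed.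

Lemma wdeg_multipartite c x i :
  wdeg (multipartite c) x i = \sum_k part_sum c x k - part_sum c x (c i).
Proof.
rewrite sum_part_sum (bigID (fun j => c j == c i))/= addrAC subrr add0r.
by apply: eq_bigl => j; rewrite eq_sym.
Qed.

(** Each vertex sees the total minus the sum of its own part. Hence only the part sums matter, and
    weight may be redistributed inside a part. *)
Lemma edge_form_multipartite c x : edge_form (multipartite c) x =
  (\sum_k part_sum c x k) ^+ 2 - \sum_k part_sum c x k ^+ 2.
Proof.
rewrite edge_form_wdeg.
under eq_bigr do rewrite wdeg_multipartite mulrBr.
rewrite sumrB -mulr_suml -(sum_part_sum c) expr2; congr (_ - _).
rewrite (partition_big c predT)//=; apply: eq_bigr => k _.
by rewrite expr2 mulr_suml; apply: eq_bigr => i /eqP->.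
Qed.

(** The total is unchanged and only two squares differ. The case x' = x serves to move a vertex, the
    case t = 0 to respread the entries. *)
Lemma edge_form_shift c c' x x' k l t : k != l ->
  part_sum c' x' k = part_sum c x k - t ->
  part_sum c' x' l = part_sum c x l + t ->
  (forall m, m != k -> m != l -> part_sum c' x' m = part_sum c x m) ->
  edge_form (multipartite c') x' = edge_form (multipartite c) x +
    2 * t * (part_sum c x k - part_sum c x l - t).
Proof.
move=> kl ek el em; rewrite !edge_form_multipartite !(sum_split2 _ kl) ek el.
under eq_bigr => m /andP[mk ml] do rewrite em//.
under [X in _ - (_ + (_ + X))]eq_bigr => m /andP[mk ml] do rewrite em//.
by ring.
Qed.

End Multipartite.

(** * Moving one vertex between two parts *)

Section Rebalancing.
Variables (R : realType) (p : R) (n r : nat).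
Hypothesis p1 : 1 < p.
Implicit Types (c : {ffun 'I_n -> 'I_r}) (x : 'rV[R]_n).

Let p0 : 0 < p. Proof. exact: lt_trans ltr01 p1. Qed.

(** A vertex with entry 0 would have weighted degree 0, so its part would carry the total sum; the
    square of the total then cancels and the edge form is at most 0. *)
Lemma multipartite_extremal_gt0 c x : p_sphere p x -> (forall i, 0 <= x 0 i) ->
  edge_form (multipartite c) x = p_spectral_radius p (multipartite c) ->
  0 < p_spectral_radius p (multipartite c) -> forall i, 0 < x 0 i.
Proof.
move=> xS x0 xe L0 i; rewrite lt_neqAle x0 andbT eq_sym; apply/eqP => xi.
have := extremal_wdeg_eq0 p1 xS x0 xe xi.
rewrite wdeg_multipartite => /eqP; rewrite subr_eq0 => /eqP Se.
move: L0; rewrite -xe edge_form_multipartite Se (bigD1 (c i))//=.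
rewrite opprD addrA subrr sub0r oppr_gt0 ltNge sumr_ge0// => k _.
exact: sqr_ge0.
Qed.

(** A strict increase is enough: it excludes [c] as a maximizer among the finitely many
    colourings. *)
Lemma unbalanced_radius_lt c (k l : 'I_r) :
  0 < p_spectral_radius p (multipartite c) ->
  ((part_size c l).+1 < part_size c k)%N ->
  exists c', p_spectral_radius p (multipartite c) <
             p_spectral_radius p (multipartite c').
Proof.
set L := p_spectral_radius p (multipartite c) => L0 lk.
have kl : k != l by apply: contraTneq lk => ->; rewrite -leqNgt.
have [u0 u0k] : exists u, c u == k.
  have : (0 < part_size c k)%N by lia.
  by case/card_gt0P => u; rewrite inE; exists u.
have n0 : (0 < n)%N by apply: leq_trans (ltn_ord u0).
have [x [xS x0 xe]] := radius_attained p1 (multipartite c) n0.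
have xpos := multipartite_extremal_gt0 xS x0 xe L0.
set s := part_sum c x k; set t := part_sum c x l.
pose mv u : {ffun 'I_n -> 'I_r} := [ffun i => if i == u then l else c i].
have mvk u : c u == k -> forall i, (mv u i == k) = (c i == k) && (i != u).
  move=> _ i; rewrite ffunE; case: (i =P u) => [->|_]; last by rewrite andbT.
  by rewrite andbF eq_sym (negPf kl).
have mvl u i : (mv u i == l) = (c i == l) || (i == u).
  by rewrite ffunE; case: (i == u); rewrite ?eqxx ?orbT ?orbF.
have mvm u m : c u == k -> m != k -> m != l -> forall i, (mv u i == m) = (c i == m).
  move=> /eqP uk mk ml i; rewrite ffunE; case: (i =P u) => // ->.
  by rewrite uk !(eq_sym _ m) (negPf mk) (negPf ml).
(* If some vertex of part [k] weighs less than [s - t], moving it to part [l]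
   without changing [x] increases the edge form. *)
have [u /andP[uk ult]|] := pickP (fun u => (c u == k) && (x 0 u < s - t)).
  exists (mv u); have [_ ub] := p_spectral_radius_max (multipartite (mv u)) n0 (ltW p1).
  apply: lt_le_trans (ub _ xS).
  rewrite (@edge_form_shift _ _ _ c (mv u) x x k l (x 0 u) kl).
  - by rewrite xe ltrDl mulr_gt0 ?mulr_gt0// subr_gt0.
  - rewrite /part_sum (eq_bigl _ _ (mvk u uk)) [in RHS](bigD1 u)//=.
    by rewrite addrAC subrr add0r.
  - rewrite /part_sum (eq_bigl _ _ (mvl u)) (bigD1 u)/= ?eqxx ?orbT// addrC.
    congr (_ + _); apply: eq_bigl => i; case: (i =P u) => [->|_]; last by rewrite orbF andbT.
    by rewrite (eqP uk) andbF (negPf kl).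
  - by move=> m mk ml; rewrite /part_sum (eq_bigl _ _ (mvm u m uk mk ml)).
move=> hle; have {}hle u : c u == k -> s - t <= x 0 u.
  by move=> uk; have := hle u; rewrite uk/= => /negbT; rewrite -leNgt.
set a := part_size c k in lk *; set b := part_size c l in lk *.
have s0 : 0 < s by rewrite /s /part_sum (bigD1 u0)//= ltr_pwDl// sumr_ge0.
have ast : a%:R * (s - t) <= s.
  rewrite -[leRHS]/(\sum_(i | c i == k) x 0 i).
  have <- : \sum_(i | c i == k) (s - t) = a%:R * (s - t).
    by rewrite sumr_const mulr_natl /a /part_size cardsE.
  exact: ler_sum.
(* An empty part [l] would give t = 0 and a s <= s, although a >= 2. *)
have b_gt0 : (0 < b)%N.
  rewrite lt0n; apply/negP => /eqP b0.
  have t0 : t = 0.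
    rewrite /t /part_sum big_pred0// => i; apply/negP => il.
    by have := card0_eq b0 i; rewrite !inE il.
  move: ast; rewrite t0 subr0 leNgt ltr_pMl// ltr1n; lia.
(* Otherwise move any vertex and spread the same part sums evenly: the edge form
   is unchanged and the norm drops. *)
pose c' := mv u0; pose m : R := a%:R - 1.
have a_eq : a%:R = m + 1 by rewrite /m subrK.
have card_k : #|[pred i | c' i == k]|%:R = m.
  rewrite /m /a /part_size (cardsD1 u0) inE u0k natrD addrAC subrr add0r.
  by rewrite -cardsE; congr (_%:R); apply: eq_card => i; rewrite !inE mvk// andbC.
have card_l : #|[pred i | c' i == l]|%:R = b%:R + 1 :> R.
  rewrite natr1 /b /part_size.
  have -> : #|[pred i | c' i == l]| = #|u0 |: [set i | c i == l]%SET|.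
    by apply: eq_card => i; rewrite !inE mvl orbC.
  by rewrite cardsU1 inE (eqP u0k) (negPf kl).
have b1 : 1 <= b%:R :> R by rewrite ler1n.
have bm : b%:R + 1 <= m by rewrite lerBrDr natr1 natr1 ler_nat.
have m0 : 0 < m by lra.
have st : m * s <= (m + 1) * t by move: ast; rewrite a_eq; lra.
have t0 : 0 < t.
  have m10 : 0 < m + 1 by lra.
  by rewrite -(pmulr_rgt0 _ m10) (lt_le_trans _ st)// mulr_gt0.
pose x' : 'rV[R]_n := \row_i
  (if c' i == k then s / m else if c' i == l then t / (b%:R + 1) else x 0 i).
have x'k i : c' i == k -> x' 0 i = s / m by move=> ik; rewrite mxE ik.
have x'l i : c' i == l -> x' 0 i = t / (b%:R + 1).
  by move=> il; rewrite mxE il (eqP il) eq_sym (negPf kl).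
have x'q q i : q != k -> q != l -> c' i == q -> x' 0 i = x 0 i.
  by move=> qk ql /eqP iq; rewrite mxE iq (negPf qk) (negPf ql).
have eL : edge_form (multipartite c') x' = L.
  rewrite (@edge_form_shift _ _ _ c c' x x' k l 0 kl).
  - by rewrite mulr0 mul0r addr0.
  - rewrite subr0 [LHS](eq_bigr (fun=> s / m)); last exact: x'k.
    by rewrite sumr_const -mulr_natl card_k -/s mulrCA divff ?mulr1 ?gt_eqF.
  - rewrite addr0 [LHS](eq_bigr (fun=> t / (b%:R + 1))); last exact: x'l.
    by rewrite sumr_const -(mulr_natl (t / (b%:R + 1))) card_l -/t mulrCA divff ?mulr1// gt_eqF//; lra.
  - move=> q qk ql; rewrite [LHS](eq_bigr (fun i => x 0 i)); last by move=> i; exact: x'q.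
    by rewrite /part_sum (eq_bigl _ _ (mvm u0 q u0k qk ql)).
pose F (d : {ffun 'I_n -> 'I_r}) (y : 'rV[R]_n) q := \sum_(i | d i == q) `|y 0 i| `^ p.
have FE d (y : 'rV[R]_n) : \sum_i `|y 0 i| `^ p =
    F d y k + (F d y l + \sum_(q | (q != k) && (q != l)) F d y q).
  by rewrite (partition_big d predT)//= (sum_split2 _ kl).
have Fk' : F c' x' k = m * (s / m) `^ p.
  rewrite /F (eq_bigr (fun=> (s / m) `^ p)) ?sumr_const -?(mulr_natl ((s / m) `^ p)) ?card_k//.
  by move=> i ik; rewrite x'k// ger0_norm// divr_ge0 ?ltW.
have Fl' : F c' x' l = (b%:R + 1) * (t / (b%:R + 1)) `^ p.
  rewrite /F (eq_bigr (fun=> (t / (b%:R + 1)) `^ p)) ?sumr_const -?(mulr_natl ((t / (b%:R + 1)) `^ p)) ?card_l//.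
  by move=> i il; rewrite x'l// ger0_norm// divr_ge0 ?ltW//; lra.
have Fq' q : q != k -> q != l -> F c' x' q = F c x q.
  move=> qk ql; rewrite /F (eq_bigr (fun i => `|x 0 i| `^ p)).
    by rewrite (eq_bigl _ _ (mvm u0 q u0k qk ql)).
  by move=> i iq; rewrite (x'q q i).
have Fx q : F c x q = \sum_(i | c i == q) x 0 i `^ p.
  by apply: eq_bigr => i _; rewrite ger0_norm.
have Fk : (m + 1) * (s / (m + 1)) `^ p <= F c x k.
  rewrite Fx; apply: (power_mean p1) => //.
  by rewrite -a_eq /a /part_size cardsE.
have Fl : b%:R * (t / b%:R) `^ p <= F c x l.
  rewrite Fx; apply: (power_mean p1) => //.
  by rewrite /b /part_size cardsE.
set N' := \sum_i `|x' 0 i| `^ p.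
(* The old parts [k] and [l] contribute at least their evenly spread values, which exceed the new
   contribution; the other parts are untouched. *)
have N'1 : N' < 1.
  have lt := powR_rebalance_lt p1 b1 bm s0 st.
  have e1 := xS; rewrite /p_sphere/= (FE c) in e1.
  have e2 : N' = m * (s / m) `^ p + ((b%:R + 1) * (t / (b%:R + 1)) `^ p +
      \sum_(q | (q != k) && (q != l)) F c x q).
    rewrite /N' (FE c') Fk' Fl'; congr (_ + (_ + _)).
    by apply: eq_bigr => q /andP[]; exact: Fq'.
  lra.
have N'0 : 0 < N'.
  have F0 q : 0 <= F c' x' q by apply: sumr_ge0 => i _; exact: powR_ge0.
  rewrite /N' (FE c') Fk' ltr_pwDl//.
    by rewrite mulr_gt0// powR_gt0// divr_gt0.
  by rewrite addr_ge0// sumr_ge0.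
(* The vector [x'] still yields [L] with a power sum below 1, so normalizing it yields more than
   [L]. *)
have := edge_form_le_radius p1 (multipartite c') N'0; rewrite -/N' eL => Lle.
exists c'; apply: (le_lt_trans Lle).
have P0 : 0 < N' `^ (2 / p) by exact: powR_gt0.
rewrite gtr_pMr; last first.
  by rewrite -(pmulr_lgt0 _ P0) (lt_le_trans L0 Lle).
have q0 : 0 < 2 / p by rewrite divr_gt0.
by have := gt0_ltr_powR q0 _ _ N'1; rewrite powR1 !nnegrE (ltW N'0) ler01; exact.
Qed.

End Rebalancing.

(** * Balanced colourings *)

(** Equal fibre sizes make the two tuples of values rearrangements of each other. *)
Lemma perm_of_fiber_cards (T : eqType) (n : nat) (f g : 'I_n -> T) :
  (forall v, #|[pred i | f i == v]| = #|[pred i | g i == v]|) ->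
  exists s : 'S_n, forall i, f i = g (s i).
Proof.
move=> fg; have : perm_eq [tuple f i | i < n] [tuple g i | i < n].
  apply/allP => v _ /=; apply/eqP.
  rewrite !count_map -!size_filter.
  by have := fg v; rewrite !cardE /enum_mem -!enumT.
case/tuple_permP => s e; exists s => i.
have /(congr1 (fun u => tnth u i)) : [tuple f i | i < n] =
  [tuple tnth [tuple g i | i < n] (s i) | i < n] by exact: val_inj.
by rewrite !tnth_mktuple.
Qed.

(** With q the quotient, a value below q keeps all others at most q and the sum below r q; a value
    above q + 1 keeps all others at least q + 1 and the sum at least r (q + 1). *)
Lemma balanced_bounds (r n : nat) (f : 'I_r -> nat) :
  (forall k l, f k <= (f l).+1)%N -> (\sum_k f k)%N = n ->
  forall k, (n %/ r <= f k <= (n %/ r).+1)%N.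
Proof.
move=> fb fs k; have r0 : (0 < r)%N by exact: leq_ltn_trans (ltn_ord k).
have dn := divn_eq n r; have dm := ltn_pmod n r0.
set q := (n %/ r)%N in dn *; set m := (n %% r)%N in dn dm.
have rq v : (\sum_(l < r | l != k) v = r.-1 * v)%N.
  by rewrite sum_nat_const cardC1 card_ord.
have rm v : (v + r.-1 * v = v * r)%N by rewrite -mulSn prednK// mulnC.
rewrite (bigD1 k)//= in fs.
apply/andP; split; rewrite leqNgt; apply/negP => kq.
  have : (\sum_(l < r | l != k) f l <= \sum_(l < r | l != k) q)%N.
    by apply: leq_sum => l _; exact: leq_trans (fb l k) kq.
  rewrite rq => /(leq_add kq); rewrite rm addSn fs; clearbody q m; lia.
have : (\sum_(l < r | l != k) q.+1 <= \sum_(l < r | l != k) f l)%N.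
  by apply: leq_sum => l _; have := fb k l; lia.
rewrite rq => /(leq_add (ltnW kq)); rewrite rm fs mulSn; clearbody q m; lia.
Qed.

(** Only the values q and q + 1 occur, and the sum determines how often each does. *)
Lemma balanced_perm (r : nat) (f g : 'I_r -> nat) :
  (forall k l, f k <= (f l).+1)%N -> (forall k l, g k <= (g l).+1)%N ->
  (\sum_k f k = \sum_k g k)%N -> exists s : 'S_r, forall k, f k = g (s k).
Proof.
move=> fb gb fg; set n := (\sum_k f k)%N in fg; set q := (n %/ r)%N.
have fq := balanced_bounds fb erefl; rewrite -/n -/q in fq.
have gq := balanced_bounds gb (esym fg); rewrite -/q in gq.
have large (h : 'I_r -> nat) : (forall k, q <= h k <= q.+1)%N -> (\sum_k h k)%N = n ->
    (r * q + #|[pred k | h k == q.+1]| = n)%N.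
  move=> hq <-; rewrite -sum1_card big_mkcond/=.
  have -> : (r * q = \sum_(k < r) q)%N by rewrite sum_nat_const card_ord.
  rewrite -big_split/=; apply: eq_bigr => k _; have := hq k; rewrite !inE.
  case: eqP; lia.
have small (h : 'I_r -> nat) : (forall k, q <= h k <= q.+1)%N ->
    (#|[pred k | h k == q]| + #|[pred k | h k == q.+1]| = r)%N.
  move=> hq; rewrite -[RHS]card_ord -(cardC [pred k | h k == q]); congr (_ + _)%N.
  by apply: eq_card => k; rewrite !inE; have := hq k; lia.
apply: perm_of_fiber_cards => v.
have e1 := large f fq erefl; have e2 := large g gq (esym fg).
have e3 := small f fq; have e4 := small g gq.
have [->|vq] := eqVneq v q; first by lia.
have [->|vq1] := eqVneq v q.+1; first by lia.
have none (h : 'I_r -> nat) : (forall k, q <= h k <= q.+1)%N ->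
    #|[pred k | h k == v]| = 0%N.
  by move=> hq; apply: eq_card0 => k; rewrite !inE; have := hq k; lia.
by rewrite !none.
Qed.

Definition balanced (n r : nat) (c : {ffun 'I_n -> 'I_r}) : Prop :=
  forall k l, (part_size c k <= (part_size c l).+1)%N.

Lemma sum_part_size (n r : nat) (c : {ffun 'I_n -> 'I_r}) :
  (\sum_k part_size c k)%N = n.
Proof.
rewrite -[RHS]card_ord -sum1_card (partition_big c predT)//=.
by apply: eq_bigr => k _; rewrite /part_size cardsE sum1_card.
Qed.

(** First the parts are matched by size through [t], then the vertices within matched parts through
    [s]; renaming parts does not affect adjacency. *)
Lemma balanced_isomorphic (n r : nat) (c d : {ffun 'I_n -> 'I_r}) :
  balanced c -> balanced d ->
  exists s : 'S_n, forall i j, (d (s i) != d (s j)) = (c i != c j).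
Proof.
move=> bc bd; have [|t te] := balanced_perm bc bd.
  by rewrite !sum_part_size.
have [|s se] := @perm_of_fiber_cards _ _ c (fun i => (t^-1)%g (d i)).
  move=> v; have := te v; rewrite /part_size !cardsE => ->.
  by apply: eq_card => i; rewrite !inE (canF_eq (permKV t)).
by exists s => i j; rewrite !se (inj_eq perm_inj).
Qed.

Lemma turan_multipartite (r n : nat) (T : sgraph n) : (0 < r)%N -> is_turan r T ->
  exists2 d : {ffun 'I_n -> 'I_r}, balanced d & forall i j, T i j = (d i != d j).
Proof.
move=> r0 [c [Tc cs]]; exists (finfun c); last by move=> i j; rewrite !ffunE.
have ps k : part_size (finfun c) k = #|[set i | c i == k]%SET|.
  by apply: eq_card => i; rewrite !inE ffunE.
have le1 : (n %/ r <= (n + r.-1) %/ r)%N by apply: leq_div2r; lia.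
have le2 : ((n + r.-1) %/ r <= (n %/ r).+1)%N.
  have : ((n + r.-1) %/ r <= (n + r) %/ r)%N by apply: leq_div2r; lia.
  by rewrite (divnDr n (dvdnn r)) divnn r0 addn1.
by move=> k l; rewrite !ps; case: (cs k) => ->; case: (cs l) => ->; lia.
Qed.

(** * Majorizing a clique-free graph by a colouring *)

Lemma clique_free_card (r n : nat) (G : sgraph n) (B : {set 'I_n}) :
  clique_free r.+1 G -> {in B &, forall i j, i != j -> G i j} -> (#|B| <= r)%N.
Proof.
move=> Gfree clB; rewrite leqNgt; apply/negP => rB; apply: Gfree.
exists (fun i => enum_val (widen_ord rB i)); split.
  by move=> i j /enum_val_inj/(congr1 val)/= /ord_inj.
move=> i j /= ij; apply: clB; rewrite ?enum_valP//.
by rewrite (inj_eq enum_val_inj) -val_eqE.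
Qed.

Lemma clique_free_multipartite (R : realDomainType) (r n : nat) (G : sgraph n)
    (x : 'I_n -> R) : (0 < r)%N ->
  clique_free r.+1 G -> (forall i, 0 <= x i) ->
  exists c : {ffun 'I_n -> 'I_r},
    (forall i, \sum_(j | G i j) x j <= \sum_(j | c i != c j) x j) /\
    ((forall i, 0 < x i) ->
     (forall i, \sum_(j | G i j) x j = \sum_(j | c i != c j) x j) ->
     forall i j, G i j = (c i != c j)).
Proof.
case: r => // r _ Gfree x0.
have [|c [cr cle ceq]] := @erdos_majorization R n G x r.+1 [set: 'I_n]%SET x0.
  by move=> B _; exact: clique_free_card.
have cE i j : ((inord (c i) : 'I_r.+1) != inord (c j)) = (c i != c j).
  by rewrite -val_eqE/= !inordK ?cr ?inE.
have sumT (P : pred 'I_n) : \sum_(j | (j \in [set: 'I_n]%SET) && P j) x j = \sum_(j | P j) x j.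
  by apply: eq_bigl => j; rewrite inE.
exists [ffun i => inord (c i)]; split => [i|xpos e i j].
  rewrite [leRHS](eq_bigl (fun j => c i != c j)); last by move=> j; rewrite !ffunE.
  by have := cle i; rewrite !sumT; apply; rewrite inE.
rewrite !ffunE cE; apply: ceq; rewrite ?inE// => k _; rewrite !sumT e.
by apply: eq_bigl => l; rewrite !ffunE.
Qed.

(** * Strict extremality of the Turan graph *)

Unset Implicit Arguments.

Theorem theorem1 (R : realType) (r : nat) (p : R) (n : nat) (G T : sgraph n) :
  (2 <= r)%N -> 1 < p ->
  is_turan r T -> clique_free r.+1 G -> ~ isomorphic G T ->
  p_spectral_radius p G < p_spectral_radius p T.
Proof.
move=> r2 p1 Tturan Gfree GT; rewrite ltNge; apply/negP => leTG; apply: GT.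
(* On at most one vertex there is a single graph. *)
have [n1|n1] := leqP n 1.
  exists 1%g => i j; have -> : j = i by apply: ord_inj; have := ltn_ord i; have := ltn_ord j; lia.
  by rewrite !adj_irr.
have n0 := ltnW n1; have r0 := ltnW r2.
have [d dbal Td] := turan_multipartite r0 Tturan.
pose L (c : {ffun 'I_n -> 'I_r}) := p_spectral_radius p (multipartite c).
have [c0 c0max] : exists c0, forall c, L c <= L c0.
  have [c0 _ c0max] := @arg_maxP _ _ _ d predT L isT.
  by exists c0 => c; exact: c0max.
have L0 : 0 < L c0.
  (* Separating vertex 0 from the others gives an edge, as r and n are at least 2. *)
  pose c1 : {ffun 'I_n -> 'I_r} :=
    [ffun i : 'I_n => if (i == 0 :> nat) then Ordinal r0 else Ordinal r2].
  apply: lt_le_trans (c0max c1).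
  by apply: (@radius_gt0 _ p p1 _ _ (Ordinal n0) (Ordinal n1)); rewrite /= !ffunE.
have max_balanced c : L c0 <= L c -> balanced c.
  move=> c0c k l; rewrite leqNgt; apply/negP => lk.
  have [c' lt] := unbalanced_radius_lt p1 (lt_le_trans L0 c0c) lk.
  by have := le_lt_trans c0c lt; rewrite ltNge c0max.
have LT : L c0 <= p_spectral_radius p T.
  apply: radius_le_isomorphic => //.
  have [s se] := balanced_isomorphic (max_balanced _ (lexx _)) dbal.
  by exists s => i j; rewrite Td se.
have [x [xS x0 xe]] := radius_attained p1 G n0.
have [c [cle ceq]] := clique_free_multipartite r0 Gfree x0.
have [_ ub] := p_spectral_radius_max (multipartite c) n0 (ltW p1).
have Gle : edge_form G x <= edge_form (multipartite c) x.
  by rewrite !edge_form_wdeg; apply: ler_sum => i _; rewrite ler_wpM2l// cle.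
(* The bounds run from [L c0] through [T], [G] and [c] back to [L c0], so equality holds
   throughout. *)
have Lc : L c0 <= L c.
  by rewrite (le_trans LT)// (le_trans leTG)// -xe (le_trans Gle)// ub.
have LG : L c <= edge_form G x.
  by rewrite xe; apply: le_trans leTG; apply: le_trans LT; exact: c0max.
have ex : edge_form (multipartite c) x = L c.
  by apply/eqP; rewrite eq_le ub//= (le_trans LG).
have eG : edge_form G x = edge_form (multipartite c) x.
  by apply/eqP; rewrite eq_le Gle ex.
have xpos := multipartite_extremal_gt0 p1 xS x0 ex (lt_le_trans L0 Lc).
have Gc : forall i j, G i j = (c i != c j).
  apply: ceq => // i; apply/eqP; rewrite -subr_eq0 -oppr_eq0 opprB.
  (* The two edge forms at [x] differ by a sum of nonnegative terms; it vanishes, and positive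
     entries make the weighted degrees agree vertex by vertex. *)
  have /psumr_eq0P : \sum_i x 0 i * (wdeg (multipartite c) x i - wdeg G x i) = 0.
    under eq_bigr do rewrite mulrBr.
    by rewrite sumrB -!edge_form_wdeg eG subrr.
  move/(_ _ i isT)/eqP; rewrite mulf_eq0 gt_eqF ?xpos//=; apply=> k _.
  by rewrite mulr_ge0// subr_ge0 cle.
have [s se] := balanced_isomorphic (max_balanced _ Lc) dbal.
by exists s => i j; rewrite Td se Gc.
Qed.
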